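(* Let $M\ge0$, and let $A_n(\lambda)$ be the polynomials defined by $A_0(\lambda)=1$, $A_1(\lambda)=\lambda-\frac{1+2M}{1+M}$ and $A_n(\lambda)=(\lambda-2)A_{n-1}(\lambda)-A_{n-2}(\lambda)$ for $n\ge2$. Then the smallest zero $\mu_{1,n}$ of $A_n(\lambda)$ satisfies $$\mu_{1,n}>\frac{1+(n+1)M}{n(n+1)(3+(n+2)M)}\qquad\text{for all } n\ge1.$$
   Context: The zeros of $A_n$ are real and positive. The number $\mu_{1,n}$ arises from the Markov-Bernstein inequality $c_1((p')^2)\le\frac1{\mu_{1,n}}c_0(p^2)$ for real polynomials $p$ of degree at most $n$, where $c_0(p)=\int_0^\infty p(x)e^{-x}dx+Mp(0)$ and $c_1(p)=\int_0^\infty p(x)e^{-x}dx$. *)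

(* Defs.v *)
From HB Require Import structures.
From mathcomp Require Import all_boot all_order all_algebra.
From mathcomp Require Import all_reals.

Set Implicit Arguments.
Unset Strict Implicit.
Unset Printing Implicit Defensive.

Import Order.TTheory GRing.Theory Num.Theory.
Local Open Scope ring_scope.

Fixpoint A (R : realType) (M : R) (n : nat) {struct n} : {poly R} :=
  match n with
  | 0 => 1
  | k.+1 =>
    match k with
    | 0 => 'X - ((1 + 2 * M) / (1 + M))%:P
    | m.+1 => ('X - 2%:P) * A M k - A M m
    end
  end.

(* Only zeros in R are compared: all complex zeros of the polynomials A M n
   (for 0 <= M) are real, so nothing is lost. *)
Definition smallest_zero (R : realType) (p : {poly R}) (mu : R) : Prop :=
  root p mu /\ forall x : R, root p x -> mu <= x.

(* Main.v *)
Require Import Defs.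
From HB Require Import structures.
From mathcomp Require Import all_boot all_order all_algebra.
From mathcomp Require Import all_reals.
From mathcomp Require Import polyrcf ring lra.

Set Implicit Arguments.
Unset Strict Implicit.
Unset Printing Implicit Defensive.

Import Order.TTheory GRing.Theory Num.Theory.
Local Open Scope ring_scope.

(** The signed polynomials [B n = (-1)^n A n] satisfy
[B (n+2) = (2 - x) B (n+1) - B n] and are at least 1 for [x <= 0]. At
the smallest zero [mu] of [B (n+1)] one has [B (n+2) mu = - B n mu < 0], so the
smallest zeros decrease with [n] and are positive. At the smallest zero [mu] of
[B n], the differences [e k = B k 0 - B k mu] have centered second
differences [mu * B k mu], which lie between 0 and [mu * B k 0]; summing twice gives
[B n 0 = e n <= mu * |(B n)' 0|], which is the asserted bound even with an extra
factor 6. *)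

Lemma smallest_zero_exists (R : realType) (p : {poly R}) (x : R) :
  p != 0 -> root p x -> exists mu : R, smallest_zero p mu.
Proof.
move=> p0 px.
have rootsE y : root p y = (y \in rootsR p) by rewrite -(roots_on_rootsR p0).
have : sorted <%R (rootsR p) by exact: sorted_roots.
case: (rootsR p) rootsE => [|mu s] rootsE /= srt; first by rewrite rootsE in px.
exists mu; split; first by rewrite rootsE mem_head.
move=> y; rewrite rootsE inE => /orP[/eqP->//|ys].
by have /allP/(_ y ys)/ltW := order_path_min lt_trans srt.
Qed.

(** Discrete convexity with a nonnegative first step makes [u] nondecreasing. Convexity is asked
    only up to index [n], matching the range where positivity is known later. *)
Lemma convex_ge0 (R : realDomainType) (n : nat) (u : nat -> R) :
  0 <= u 0%N -> u 0%N <= u 1%N ->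
  (forall k, (k.+1 < n)%N -> 0 <= u k.+2 - 2 * u k.+1 + u k) ->
  forall k, (k <= n)%N -> 0 <= u k.
Proof.
move=> u0 u01 cvx.
have incr k : (k < n)%N -> u k <= u k.+1.
  elim: k => [//|k IH] kn; have := cvx k kn; have := IH (ltnW kn); lra.
elim=> [//|k IH] kn; have := incr k kn; have := IH (ltnW kn); lra.
Qed.

Definition signedA (R : realType) (M : R) (n : nat) : {poly R} :=
  (-1) ^+ n *: A M n.

Section SignedA.
Variables (R : realType) (M : R).
Hypothesis M_ge0 : 0 <= M.
Local Notation B := (signedA M).
(** Since [(1 + 2 * M) / (1 + M) = 1 + d], the values of [B k] at 0 are the arithmetic progression
    [1 + k * d]. *)
Local Notation d := (M / (1 + M)).

Let M1_gt0 : 0 < 1 + M. Proof. by rewrite ltr_pwDl. Qed.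

Let d_ge0 : 0 <= d. Proof. by rewrite divr_ge0 // ltW. Qed.

Lemma root_signedA n x : root (B n) x = root (A M n) x.
Proof. by rewrite rootZ // signr_eq0. Qed.

Lemma signedA0 x : (B 0).[x] = 1.
Proof. by rewrite /signedA expr0 scale1r hornerC. Qed.

Lemma signedA1 x : (B 1).[x] = 1 + d - x.
Proof. by rewrite /signedA !hornerE; field; exact: lt0r_neq0. Qed.

Lemma signedASS n x : (B n.+2).[x] = (2 - x) * (B n.+1).[x] - (B n).[x].
Proof.
have AE : A M n.+2 = ('X - 2%:P) * A M n.+1 - A M n by [].
rewrite /signedA AE !(hornerZ, hornerD, hornerN, hornerM, hornerX, hornerC).
rewrite !exprS; ring.
Qed.

Lemma signedA_ge1 n x : x <= 0 -> 1 <= (B n).[x].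
Proof.
move=> x0.
(* Monotonicity in [n] is carried along: the increment grows by [- x * (B n.+1).[x]], which is
   nonnegative. *)
suff [] : 1 <= (B n).[x] /\ (B n).[x] <= (B n.+1).[x] by [].
have dge0 := d_ge0.
elim: n => [|n [IH1 IH2]]; first by rewrite signedA0 signedA1; lra.
rewrite signedASS; split; nra.
Qed.

Lemma smallest_zero_signedA n : exists mu : R,
  [/\ 0 < mu, smallest_zero (B n.+1) mu,
      forall x, x < mu -> 0 < (B n.+1).[x]
    & forall k x, (k <= n)%N -> x <= mu -> 0 < (B k).[x]].
Proof.
have dge0 := d_ge0.
elim: n => [|n [mu [mu_gt0 [/rootP mu0 _] pos pos']]].
  exists (1 + d); split; [lra | split | |].
  - by apply/rootP; rewrite signedA1; ring.
  - by move=> x /rootP; rewrite signedA1; lra.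
  - by move=> x; rewrite signedA1; lra.
  - by move=> k x; rewrite leqn0 => /eqP-> _; rewrite signedA0.
have neg : (B n.+2).[mu] < 0.
  by rewrite signedASS mu0; have := pos' n mu (leqnn n) (lexx _); lra.
have ge1 x : x <= 0 -> 0 < (B n.+2).[x].
  by move=> /signedA_ge1 - /(_ n.+2); lra.
have [x xmu x0] : {x : R | x \in `]0, mu[ & root (B n.+2) x}.
  apply: poly_ivtoo; first exact: ltW.
  by rewrite pmulr_rlt0 // ge1.
have Bn0 : B n.+2 != 0.
  by apply: contraTneq (ge1 0 (lexx _)) => ->; rewrite horner0 ltxx.
have [nu [nu0 nu_min]] := smallest_zero_exists Bn0 x0.
have nu_mu : nu < mu.
  by apply: le_lt_trans (nu_min _ x0) _; move: xmu; rewrite in_itv => /andP[].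
have nu_gt0 : 0 < nu.
  by rewrite ltNge; apply/negP => /ge1; rewrite (rootP nu0) ltxx.
exists nu; split=> //.
(* A nonpositive value at [y < nu] would be negative by minimality of [nu], and the sign change on
   []0, y[] would give a zero below [nu]. *)
- move=> y ynu; rewrite ltNge; apply/negP => By.
  have y_gt0 : 0 < y by rewrite ltNge; apply/negP => /ge1; lra.
  have By' : (B n.+2).[y] < 0.
    rewrite lt_neqAle By andbT; apply/negP => /nu_min; lra.
  have [z] : {z : R | z \in `]0, y[ & root (B n.+2) z}.
    apply: poly_ivtoo; first exact: ltW.
    by rewrite pmulr_rlt0 // ge1.
  by rewrite in_itv => /andP[_ zy] /nu_min; move: zy => /=; lra.
- move=> k y; rewrite leq_eqVlt => /orP[/eqP-> ynu|kn ynu].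
    by apply: pos; apply: le_lt_trans ynu nu_mu.
  by apply: pos' => //; apply: le_trans ynu (ltW nu_mu).
Qed.

(* The right-hand side is [mu] times [- (B n)' 0]. *)
Lemma smallest_zero_signedA_bound n mu :
  0 < mu -> (B n).[mu] = 0 -> (forall k, (k < n)%N -> 0 < (B k).[mu]) ->
  1 + n%:R * d <= mu * (n%:R * n.+1%:R / 2 + d * (n%:R ^+ 3 - n%:R) / 6).
Proof.
move=> mu_gt0 Bn pos; have dge0 := d_ge0.
have e_ge0 : forall k, (k <= n)%N -> 0 <= 1 + k%:R * d - (B k).[mu].
  apply: convex_ge0 => [||k kn]; rewrite ?signedA0 ?signedA1 ?signedASS.
  - lra.
  - lra.
  - have := mulr_gt0 mu_gt0 (pos _ kn).
    by rewrite -![k.+2%:R]natr1 -![k.+1%:R]natr1; lra.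
(* The cubic in [k] has centered second difference [mu * (1 + k * d)], so this gap has second
   difference [mu] times the quantity in [e_ge0]; it vanishes at [k = 0] and [k = 1]. *)
have : forall k, (k <= n)%N ->
    0 <= mu * (k%:R * k.+1%:R / 2 + d * (k%:R ^+ 3 - k%:R) / 6)
         - (1 + k%:R * d - (B k).[mu]).
  apply: convex_ge0 => [||k kn]; rewrite ?signedA0 ?signedA1 ?signedASS.
  - lra.
  - lra.
  - have := mulr_ge0 (ltW mu_gt0) (e_ge0 k.+1 (ltnW kn)).
    rewrite -![k.+3%:R]natr1 -![k.+2%:R]natr1 -![k.+1%:R]natr1.
    by lra.
move=> /(_ n (leqnn n)); rewrite Bn; lra.
Qed.

End SignedA.

Theorem mainTheorem7 (R : realType) (M : R) (hM : 0 <= M)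
    (n : nat) (hn : (1 <= n)%N) :
  exists mu : R, smallest_zero (A M n) mu /\
    (1 + n.+1%:R * M) / (n%:R * n.+1%:R * (3 + n.+2%:R * M)) < mu.
Proof.
case: n hn => // n _.
have [mu [mu_gt0 [mu0 mu_min] _ pos]] := smallest_zero_signedA hM n.
exists mu; split.
  split; first by rewrite -root_signedA.
  by move=> x; rewrite -root_signedA; apply: mu_min.
have := smallest_zero_signedA_bound hM mu_gt0 (rootP mu0)
  (fun k kn => pos k mu kn (lexx _)).
have M1 : 0 < 1 + M by lra.
have den_gt0 : 0 < n.+1%:R * n.+2%:R * (3 + n.+3%:R * M).
  by rewrite !mulr_gt0 ?ltr0n // ltr_pwDl // mulr_ge0.
rewrite ltr_pdivrMr // -(ler_pM2l M1).
have num_gt0 : 0 < 1 + n.+2%:R * M by rewrite ltr_pwDl // mulr_ge0.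
have -> : (1 + M) * (1 + n.+1%:R * (M / (1 + M))) = 1 + n.+2%:R * M.
  by rewrite -[n.+2%:R]natr1; field; exact: lt0r_neq0.
have -> : (1 + M) * (mu * (n.+1%:R * n.+2%:R / 2 +
    M / (1 + M) * (n.+1%:R ^+ 3 - n.+1%:R) / 6)) =
    mu * (n.+1%:R * n.+2%:R * (3 + n.+3%:R * M)) / 6.
  by rewrite -[n.+3%:R]natr1 -[n.+2%:R]natr1; field; exact: lt0r_neq0.
(* Strictness comes from the spare factor 6, the numerator being positive by [num_gt0]. *)
lra.
Qed.
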